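(* Let $\mathcal{D}$ be a restriction category, $\mathcal{C}$ a $2$-category, and $F\colon\mathcal{C}\to\Gamma\mathcal{D}$ a local discrete fibration. Then there is a unique restriction functor $\hat F\colon\hat{\mathcal{C}}\to\mathcal{D}$ (with $\hat{\mathcal{C}}$ a restriction category) such that $\Gamma\hat{\mathcal{C}}=\mathcal{C}$ and $\Gamma\hat F=F$.
   Context: A restriction category is a category $\mathcal{C}$ with an operation assigning to each $f\colon A\to B$ a map $\bar f\colon A\to A$ such that: (R1) $f\bar f=f$; (R2) $\bar f\bar g=\bar g\bar f$ for $f\colon A\to B$, $g\colon A\to C$; (R3) $\overline{g\bar f}=\bar g\bar f$ for $f\colon A\to B$, $g\colon A\to C$; (R4) $\bar g f=f\,\overline{gf}$ for $f\colon A\to B$, $g\colon B\to C$. A restriction functor is a functor with $F\bar f=\overline{Ff}$. Each homset is partially ordered by $f\leqslant g$ iff $g\bar f=f$; composition and restriction functors preserve this order. $\Gamma\mathcal{C}$ is the (locally partially ordered) $2$-category with underlying category that of $\mathcal{C}$ and a unique $2$-cell $f\Rightarrow g$ exactly when $f\leqslant g$; $\Gamma F$ is the $2$-functor acting as $F$ does. A functor $p\colon\mathcal{E}\to\mathcal{B}$ is a discrete fibration if for every $e\in\mathcal{E}$ and $\gamma\colon b\to pe$ in $\mathcal{B}$ there is a unique map $\gamma'$ of $\mathcal{E}$ with codomain $e$ and $p(\gamma')=\gamma$. A $2$-functor $F\colon\mathcal{K}\to\mathcal{L}$ is a local discrete fibration if each functor $\mathcal{K}(X,Y)\to\mathcal{L}(FX,FY)$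 is a discrete fibration. (A locally partially ordered $2$-category, and its hom-categories, are identified with the corresponding order structure on homs.) *)

(* Defs.v *)
From Stdlib Require Import ProofIrrelevance.

Set Implicit Arguments.
Unset Strict Implicit.
Unset Printing Implicit Defensive.

Record Category : Type := {
  ob :> Type;
  hom : ob -> ob -> Type;
  idm : forall A : ob, hom A A;
  comp : forall A B C : ob, hom B C -> hom A B -> hom A C;
  comp_idl : forall (A B : ob) (f : hom A B), comp (idm B) f = f;
  comp_idr : forall (A B : ob) (f : hom A B), comp f (idm A) = f;
  comp_assoc : forall (A B C D : ob)
    (h : hom C D) (g : hom B C) (f : hom A B),
    comp h (comp g f) = comp (comp h g) f
}.

Arguments hom {_} _ _.
Arguments idm {_} A.
Arguments comp {_ A B C} g f.

Declare Scope cat_scope.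
Open Scope cat_scope.
Notation "g ∘ f" := (comp g f) (at level 40, left associativity) : cat_scope.

Record Functor (C D : Category) : Type := {
  fob :> C -> D;
  fmap : forall A B : C, hom A B -> hom (fob A) (fob B);
  fmap_id : forall A : C, fmap (idm A) = idm (fob A);
  fmap_comp : forall (A B X : C) (g : hom B X) (f : hom A B),
    fmap (g ∘ f) = fmap g ∘ fmap f
}.

Arguments fmap {C D} F {A B} f : rename.

Definition id_functor (C : Category) : Functor C C :=
  {| fob := fun A : C => A;
     fmap := fun _ _ f => f;
     fmap_id := fun _ => eq_refl;
     fmap_comp := fun _ _ _ _ _ => eq_refl |}.

Definition comp_functor (C D E : Category) (G : Functor D E) (F : Functor C D) :
  Functor C E.
Proof.
  refine {| fob := fun A => G (F A); fmap := fun A B f => fmap G (fmap F f) |}.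
  - intros A; now rewrite !fmap_id.
  - intros A B X g f; now rewrite !fmap_comp.
Defined.

(* The identity, seen as a functor between two categories known to be equal. *)
Definition functor_of_eq (C D : Category) (e : C = D) : Functor C D :=
  match e in _ = D' return Functor C D' with eq_refl => id_functor C end.

Definition maps_into (C : Category) (c : C) : Type := {b : C & hom b c}.

Definition fmap_into (E B : Category) (p : Functor E B) (e : E)
  (g : maps_into e) : maps_into (p e) :=
  existT (fun b : B => hom b (p e)) (p (projT1 g)) (fmap p (projT2 g)).

(* The equation below lives among maps into [p e] with arbitrary domain, so it
   includes the equality of [b] with the image of the domain of the lift. *)
Definition discrete_fibration (E B : Category) (p : Functor E B) : Prop :=
  forall (e : E) (b : B) (g : hom b (p e)),
    exists! g' : maps_into e, fmap_into p g' = existT _ b g.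

(* Strict associativity and unitality only hold between 2-cells whose sources
   and targets are propositionally equal, hence the transport [cast]. *)
Definition cast (T : Type) (R : T -> T -> Type) (f f' g g' : T)
  (p : f = f') (q : g = g') (a : R f g) : R f' g' :=
  eq_rect g (R f') (eq_rect f (fun x => R x g) a f' p) g' q.

Record TwoCategory : Type := {
  underlying :> Category;
  cell : forall X Y : underlying, hom X Y -> hom X Y -> Type;
  cell_id : forall (X Y : underlying) (f : hom X Y), cell f f;
  vcomp : forall (X Y : underlying) (f g h : hom X Y),
    cell g h -> cell f g -> cell f h;
  hcomp : forall (X Y Z : underlying) (g g' : hom Y Z) (f f' : hom X Y),
    cell g g' -> cell f f' -> cell (g ∘ f) (g' ∘ f');
  vcomp_idl : forall (X Y : underlying) (f g : hom X Y) (a : cell f g),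
    vcomp (cell_id g) a = a;
  vcomp_idr : forall (X Y : underlying) (f g : hom X Y) (a : cell f g),
    vcomp a (cell_id f) = a;
  vcomp_assoc : forall (X Y : underlying) (f g h k : hom X Y)
    (c : cell h k) (b : cell g h) (a : cell f g),
    vcomp c (vcomp b a) = vcomp (vcomp c b) a;
  hcomp_id : forall (X Y Z : underlying) (g : hom Y Z) (f : hom X Y),
    hcomp (cell_id g) (cell_id f) = cell_id (g ∘ f);
  interchange : forall (X Y Z : underlying)
    (g g' g'' : hom Y Z) (f f' f'' : hom X Y)
    (b' : cell g' g'') (b : cell g g') (a' : cell f' f'') (a : cell f f'),
    hcomp (vcomp b' b) (vcomp a' a) = vcomp (hcomp b' a') (hcomp b a);
  hcomp_unitl : forall (X Y : underlying) (f f' : hom X Y) (a : cell f f'),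
    cast (R := @cell X Y) (comp_idl f) (comp_idl f')
      (hcomp (cell_id (idm Y)) a) = a;
  hcomp_unitr : forall (X Y : underlying) (f f' : hom X Y) (a : cell f f'),
    cast (R := @cell X Y) (comp_idr f) (comp_idr f')
      (hcomp a (cell_id (idm X))) = a;
  hcomp_assoc : forall (X Y Z W : underlying) (h h' : hom Z W)
    (g g' : hom Y Z) (f f' : hom X Y)
    (c : cell h h') (b : cell g g') (a : cell f f'),
    cast (R := @cell X W) (comp_assoc h g f) (comp_assoc h' g' f')
      (hcomp c (hcomp b a)) = hcomp (hcomp c b) a
}.

Arguments cell {_ X Y} f g.
Arguments cell_id {_ X Y} f.
Arguments vcomp {_ X Y f g h} b a.
Arguments hcomp {_ X Y Z g g' f f'} b a.

Definition hom_cat (K : TwoCategory) (X Y : K) : Category :=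
  {| ob := hom X Y;
     hom := fun f g => cell f g;
     idm := fun f => cell_id f;
     comp := fun _ _ _ b a => vcomp b a;
     comp_idl := fun f g a => vcomp_idl a;
     comp_idr := fun f g a => vcomp_idr a;
     comp_assoc := fun _ _ _ _ c b a => vcomp_assoc c b a |}.

Record TwoFunctor (K L : TwoCategory) : Type := {
  ufun :> Functor K L;
  cmap : forall (X Y : K) (f g : hom X Y),
    cell f g -> cell (fmap ufun f) (fmap ufun g);
  cmap_id : forall (X Y : K) (f : hom X Y),
    cmap (cell_id f) = cell_id (fmap ufun f);
  cmap_vcomp : forall (X Y : K) (f g h : hom X Y) (b : cell g h) (a : cell f g),
    cmap (vcomp b a) = vcomp (cmap b) (cmap a);
  cmap_hcomp : forall (X Y Z : K) (g g' : hom Y Z) (f f' : hom X Y)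
    (b : cell g g') (a : cell f f'),
    cast (R := @cell L (ufun X) (ufun Z))
      (fmap_comp ufun g f) (fmap_comp ufun g' f')
      (cmap (hcomp b a)) = hcomp (cmap b) (cmap a)
}.

Arguments cmap {K L} F {X Y f g} a : rename.

Lemma cast_trans (T : Type) (R : T -> T -> Type) (f f' f'' g g' g'' : T)
  (p : f = f') (p' : f' = f'') (q : g = g') (q' : g' = g'')
  (r : f = f'') (s : g = g'') (a : R f g) :
  cast r s a = cast p' q' (cast p q a).
Proof.
  destruct p', q', p, q.
  rewrite (proof_irrelevance _ r eq_refl), (proof_irrelevance _ s eq_refl).
  reflexivity.
Qed.

Lemma cast_map (T T' : Type) (R : T -> T -> Type) (R' : T' -> T' -> Type)
  (u : T -> T') (m : forall f g, R f g -> R' (u f) (u g)) (f f' g g' : T)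
  (p : f = f') (q : g = g') (a : R f g) :
  m _ _ (cast p q a) = cast (f_equal u p) (f_equal u q) (m _ _ a).
Proof. destruct p, q; reflexivity. Qed.

Definition comp_two_functor (K L M : TwoCategory)
  (G : TwoFunctor L M) (F : TwoFunctor K L) : TwoFunctor K M.
Proof.
  refine {| ufun := comp_functor G F;
            cmap := fun X Y f g a => cmap G (cmap F a) |}.
  - intros X Y f; now rewrite !cmap_id.
  - intros X Y f g h b a; now rewrite !cmap_vcomp.
  - intros X Y Z g g' f f' b a.
    refine (eq_trans _ (cmap_hcomp G (cmap F b) (cmap F a))).
    rewrite <- (cmap_hcomp F b a).
    rewrite (cast_map (fun f g => @cmap _ _ G _ _ f g)).
    apply cast_trans.
Defined.

Definition local_functor (K L : TwoCategory) (F : TwoFunctor K L) (X Y : K) :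
  Functor (hom_cat X Y) (hom_cat (F X) (F Y)) :=
  {| fob := (fun f => fmap F f) : hom_cat X Y -> hom_cat (F X) (F Y);
     fmap := fun f g a => cmap F a;
     fmap_id := fun f => cmap_id F f;
     fmap_comp := fun _ _ _ b a => cmap_vcomp F b a |}.

Definition local_discrete_fibration (K L : TwoCategory) (F : TwoFunctor K L) :
  Prop :=
  forall X Y : K, discrete_fibration (local_functor F X Y).

Definition bijective (A B : Type) (u : A -> B) : Prop :=
  forall b : B, exists! a : A, u a = b.

(* [Identification K L]: [K] and [L] have the same underlying category, and
   compatibly isomorphic 2-cells.  When [K] is locally partially ordered, with
   2-cells given by an order [f <= g] on homs, this says exactly that [L] has at
   most one 2-cell between two maps, and has one just when [f <= g].  Leibniz
   equality would be too strict: it would distinguish the proposition [f <= g]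
   from other types of 2-cells with at most one element. *)
Record Identification (K L : TwoCategory) : Type := {
  ident_fun :> TwoFunctor K L;
  ident_eq : underlying K = underlying L;
  ident_id : ufun ident_fun = functor_of_eq ident_eq;
  ident_bij : forall (X Y : K) (f g : hom X Y),
    bijective (fun a : cell f g => cmap ident_fun a)
}.

Record RestrictionCategory : Type := {
  rcat :> Category;
  rest : forall A B : rcat, hom A B -> hom A A;
  rest_R1 : forall (A B : rcat) (f : hom A B), f ∘ rest f = f;
  rest_R2 : forall (A B C : rcat) (f : hom A B) (g : hom A C),
    rest f ∘ rest g = rest g ∘ rest f;
  rest_R3 : forall (A B C : rcat) (f : hom A B) (g : hom A C),
    rest (g ∘ rest f) = rest g ∘ rest f;
  rest_R4 : forall (A B C : rcat) (f : hom A B) (g : hom B C),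
    rest g ∘ f = f ∘ rest (g ∘ f)
}.

Arguments rest {_ A B} f.

Record RestrictionFunctor (C D : RestrictionCategory) : Type := {
  rfun :> Functor C D;
  rfun_rest : forall (A B : C) (f : hom A B),
    fmap rfun (rest f) = rest (fmap rfun f)
}.

Definition rle (C : RestrictionCategory) (A B : C) (f g : hom A B) : Prop :=
  g ∘ rest f = f.

Lemma rle_refl (C : RestrictionCategory) (A B : C) (f : hom A B) : rle f f.
Proof. apply rest_R1. Qed.

Lemma rle_trans (C : RestrictionCategory) (A B : C) (f g h : hom A B) :
  rle g h -> rle f g -> rle f h.
Proof.
  unfold rle; intros Hgh Hfg.
  assert (E : rest f = rest g ∘ rest f) by now rewrite <- rest_R3, Hfg.
  now rewrite E, comp_assoc, Hgh.
Qed.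

Lemma rle_antisym (C : RestrictionCategory) (A B : C) (f g : hom A B) :
  rle f g -> rle g f -> f = g.
Proof.
  unfold rle; intros Hfg Hgf.
  transitivity (f ∘ rest g ∘ rest f); [now rewrite Hgf|].
  now rewrite <- comp_assoc, <- rest_R2, comp_assoc, rest_R1.
Qed.

Lemma rle_comp (C : RestrictionCategory) (X Y Z : C)
  (g g' : hom Y Z) (f f' : hom X Y) :
  rle g g' -> rle f f' -> rle (g ∘ f) (g' ∘ f').
Proof.
  unfold rle; intros Hg Hf.
  assert (E : rest (g ∘ f) = rest f ∘ rest (g ∘ f)).
  { rewrite rest_R2, <- rest_R3, <- comp_assoc; now rewrite rest_R1. }
  rewrite E, comp_assoc, <- (comp_assoc g' f' (rest f)), Hf.
  now rewrite <- comp_assoc, <- rest_R4, comp_assoc, Hg.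
Qed.

Lemma rfun_rle (C D : RestrictionCategory) (F : RestrictionFunctor C D)
  (A B : C) (f g : hom A B) : rle f g -> rle (fmap F f) (fmap F g).
Proof.
  unfold rle; intros H; now rewrite <- rfun_rest, <- fmap_comp, H.
Qed.

(* The laws hold because there is at most one 2-cell between two maps. *)
Definition Gamma (C : RestrictionCategory) : TwoCategory.
Proof.
  refine {| underlying := rcat C;
            cell := @rle C;
            cell_id := @rle_refl C;
            vcomp := @rle_trans C;
            hcomp := @rle_comp C |};
  intros; apply proof_irrelevance.
Defined.

Definition Gamma_functor (C D : RestrictionCategory)
  (F : RestrictionFunctor C D) : TwoFunctor (Gamma C) (Gamma D).
Proof.
  refine {| ufun := rfun F : Functor (Gamma C) (Gamma D);
            cmap := @rfun_rle C D F |};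
  intros; exact (proof_irrelevance (rle _ _) _ _).
Defined.

Definition RestrictionFunctorInto (D : RestrictionCategory) : Type :=
  {C : RestrictionCategory & RestrictionFunctor C D}.

(* Main.v *)
Require Import Defs.
From Stdlib Require Import ProofIrrelevance FunctionalExtensionality.
From Stdlib Require Import ClassicalEpsilon.

Set Implicit Arguments.
Unset Strict Implicit.
Unset Printing Implicit Defensive.

(** Everything rests on one cancellation principle.  As the 2-cells of
    [Gamma D] form an order, a local discrete fibration [F] lets at most one
    pair (map [f], 2-cell [f => h]) lie over a given map below [F h]: two maps
    with 2-cells to a common [h] and the same image under [F] are equal, and
    so are the 2-cells ([below_cancel], [cell_unique]).

    For [f : A -> B] the map [rest (F f)] lies below [F (idm A)], so it has a
    unique lift along [F] to a map with a 2-cell to [idm A].  That lift is the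
    restriction of [f].  Both sides of each axiom R1-R4 have 2-cells to a
    common map, because the restrictions have 2-cells to identities and
    2-cells compose horizontally; their images under [F] agree because [D]
    satisfies the axiom.  So the axiom holds by cancellation.

    The order of the resulting restriction category is that of the 2-cells
    ([cell_of_rle], [rle_of_cell]): [g ∘ rest f] always has a 2-cell to [g] and
    has image [F g ∘ rest (F f)], which is [F f] as soon as [F f <= F g].

    Conversely, the restriction in any other solution lies below an identity
    and is sent by [F] to [rest (F f)], so cancellation identifies it with the
    lift; this is [restriction_functor_into_unique]. *)

Lemma rest_rle_id (C : RestrictionCategory) (A B : C) (f : hom A B) :
  rle (rest f) (idm A).
Proof.
  unfold rle; rewrite comp_idl.
  rewrite <- (comp_idl (rest f)) at 1.
  now rewrite rest_R3, <- (comp_idl (rest (idm A))), rest_R1, comp_idl.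
Qed.

(** * Equality of functors and 2-functors *)

Lemma existT_prop_eq (A : Type) (P : A -> Prop) (x y : A) (p : P x) (q : P y) :
  x = y -> existT (fun a : A => P a : Type) x p = existT _ y q.
Proof. intros ->; now rewrite (proof_irrelevance _ p q). Qed.

Lemma comp_functor_idr (C D : Category) (F : Functor C D) :
  comp_functor F (id_functor C) = F.
Proof. destruct F; unfold comp_functor; f_equal; apply proof_irrelevance. Qed.

(** A 2-cell of [Gamma D] is a proof of an inequality, so proof irrelevance
    leaves no freedom in the action on 2-cells. *)
Lemma two_functor_into_Gamma_ext (K : TwoCategory) (D : RestrictionCategory)
  (F G : TwoFunctor K (Gamma D)) : ufun F = ufun G -> F = G.
Proof.
  destruct F as [F cF iF vF hF], G as [G cG iG vG hG]; cbn.
  intros <-.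
  assert (cF = cG) as <-.
  { do 5 (apply functional_extensionality_dep; intro).
    exact (proof_irrelevance (rle _ _) _ _). }
  f_equal; apply proof_irrelevance.
Qed.

(** * Uniqueness of the restriction structure *)

(** Two restrictions on the same category, preserved by the same functor into
    [D], have equal images.  A relation [below] that permits cancellation and
    puts both restrictions below identities therefore makes them equal.  The
    underlying categories are equated by [e] rather than shared, since that is
    what an identification of 2-categories supplies. *)
Lemma restriction_functor_into_unique (D : RestrictionCategory)
  (P Q : RestrictionFunctorInto D)
  (below : forall A B : projT1 Q, hom A B -> hom A B -> Prop)
  (cancel : forall (A B : projT1 Q) (f g h : hom A B),
    below A B f h -> below A B g h ->
    fmap (rfun (projT2 Q)) f = fmap (rfun (projT2 Q)) g -> f = g)
  (rest_below : forall (A B : projT1 Q) (f : hom A B), below A A (rest f) (idm A))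
  (e : rcat (projT1 P) = rcat (projT1 Q))
  (rest_below_e : forall (A B : projT1 P) (f : hom A B),
    below _ _ (fmap (functor_of_eq e) (rest f)) (fmap (functor_of_eq e) (idm A)))
  (over : rfun (projT2 P) = comp_functor (projT2 Q) (functor_of_eq e)) :
  Q = P.
Proof.
  destruct P as [[U r1 p1 p2 p3 p4] [G Gr]], Q as [[V r2 q1 q2 q3 q4] [H Hr]].
  cbn in *.
  destruct e; cbn in *.
  rewrite comp_functor_idr in over; subst G.
  assert (r2 = r1) as <-.
  { do 3 (apply functional_extensionality_dep; intro).
    refine (cancel _ _ _ _ _ (rest_below _ _ _) (rest_below_e _ _ _) _).
    exact (eq_trans (Hr _ _ _) (eq_sym (Gr _ _ _))). }
  assert (q1 = p1) as <- by apply proof_irrelevance.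
  assert (q2 = p2) as <- by apply proof_irrelevance.
  assert (q3 = p3) as <- by apply proof_irrelevance.
  assert (q4 = p4) as <- by apply proof_irrelevance.
  assert (Hr = Gr) as <- by apply proof_irrelevance.
  reflexivity.
Qed.

(** * Lifting the restriction along a local discrete fibration *)

Section Lifting.

Variables (D : RestrictionCategory) (C : TwoCategory).
Variable F : TwoFunctor C (Gamma D).
Hypothesis HF : local_discrete_fibration F.

(** Typed in [rcat D] rather than in [Gamma D], so that [rest] and its axioms
    apply to images. *)
Let img (A B : C) (f : hom A B) : hom (c := rcat D) (F A) (F B) := fmap F f.

Lemma img_id (A : C) : img (idm A) = idm (c := rcat D) (F A).
Proof. exact (fmap_id F A). Qed.

Lemma img_comp (A B X : C) (g : hom B X) (f : hom A B) :
  img (g ∘ f) = img g ∘ img f.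
Proof. exact (fmap_comp F g f). Qed.

(** Both pairs lift the same 2-cell of [Gamma D], namely [F f <= F h]: the
    images of [a] and [b] prove the same proposition.  Retaining the 2-cells in
    the conclusion gives uniqueness of 2-cells as well as of maps. *)
Lemma below_cancel_pair (A B : C) (f g h : hom A B)
  (a : cell f h) (b : cell g h) : img f = img g ->
  existT (fun k => cell k h) f a = existT (fun k => cell k h) g b.
Proof.
  intros E.
  destruct (HF (X := A) (Y := B) (e := h) (b := fmap F f) (cmap F a))
    as [x [_ Hx]].
  transitivity x; [symmetry|]; apply Hx.
  - reflexivity.
  - exact (existT_prop_eq (P := fun d => rle d (img h)) (cmap F b) (cmap F a)
      (eq_sym E)).
Qed.

Lemma below_cancel (A B : C) (f g h : hom A B) :
  cell f h -> cell g h -> img f = img g -> f = g.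
Proof.
  intros a b E; exact (f_equal (@projT1 _ _) (below_cancel_pair a b E)).
Qed.

Lemma cell_unique (A B : C) (f h : hom A B) (a b : cell f h) : a = b.
Proof. exact (inj_pair2 _ _ _ _ _ (below_cancel_pair a b eq_refl)). Qed.

(** Uniqueness of the pair of map and 2-cell makes it definable by unique
    choice; the 2-cell is kept as data since cells are not propositions. *)
Lemma rest_lift_exists (A B : C) (f : hom A B) :
  exists! e : {e : hom A A & cell e (idm A)}, img (projT1 e) = rest (img f).
Proof.
  assert (L : rle (rest (img f)) (img (idm A))).
  { rewrite img_id; apply rest_rle_id. }
  destruct (HF (X := A) (Y := A) (e := idm A) L) as [[e a] [E _]].
  apply (f_equal (@projT1 _ _)) in E; cbn in E.
  exists (existT _ e a); split; [exact E|].
  intros [e' a'] E'; apply below_cancel_pair; exact (eq_trans E (eq_sym E')).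
Qed.


Definition rest_lift (A B : C) (f : hom A B) : hom A A :=
  projT1 (proj1_sig (constructive_definite_description _ (rest_lift_exists f))).

Lemma rest_lift_below (A B : C) (f : hom A B) : cell (rest_lift f) (idm A).
Proof.
  exact (projT2
    (proj1_sig (constructive_definite_description _ (rest_lift_exists f)))).
Qed.

Lemma img_rest_lift (A B : C) (f : hom A B) :
  img (rest_lift f) = rest (img f).
Proof.
  exact (proj2_sig (constructive_definite_description _ (rest_lift_exists f))).
Qed.

(** This puts both sides of each restriction axiom over a common map, and
    supplies the 2-cell witnessing each inequality [g ∘ rest f <= g]. *)
Lemma comp_rest_lift_below (A B X : C) (g : hom A X) (f : hom A B) :
  cell (g ∘ rest_lift f) g.
Proof.
  rewrite <- (comp_idr g) at 2.
  exact (hcomp (cell_id g) (rest_lift_below f)).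
Qed.

Lemma rest_lift_R1 (A B : C) (f : hom A B) : f ∘ rest_lift f = f.
Proof.
  apply (below_cancel (comp_rest_lift_below f f) (cell_id f)).
  now rewrite img_comp, img_rest_lift, rest_R1.
Qed.

Lemma rest_lift_R2 (A B X : C) (f : hom A B) (g : hom A X) :
  rest_lift f ∘ rest_lift g = rest_lift g ∘ rest_lift f.
Proof.
  apply (below_cancel (h := idm A)).
  - exact (vcomp (rest_lift_below f) (comp_rest_lift_below _ g)).
  - exact (vcomp (rest_lift_below g) (comp_rest_lift_below _ f)).
  - now rewrite !img_comp, !img_rest_lift, rest_R2.
Qed.

Lemma rest_lift_R3 (A B X : C) (f : hom A B) (g : hom A X) :
  rest_lift (g ∘ rest_lift f) = rest_lift g ∘ rest_lift f.
Proof.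
  apply (below_cancel (h := idm A)).
  - apply rest_lift_below.
  - exact (vcomp (rest_lift_below g) (comp_rest_lift_below _ f)).
  - now rewrite img_comp, !img_rest_lift, img_comp, img_rest_lift, rest_R3.
Qed.

Lemma rest_lift_R4 (A B X : C) (f : hom A B) (g : hom B X) :
  rest_lift g ∘ f = f ∘ rest_lift (g ∘ f).
Proof.
  apply (below_cancel (h := f)).
  - rewrite <- (comp_idl f) at 2.
    exact (hcomp (rest_lift_below g) (cell_id f)).
  - apply comp_rest_lift_below.
  - now rewrite !img_comp, !img_rest_lift, img_comp, rest_R4.
Qed.

Definition lifted_category : RestrictionCategory :=
  {| rcat := C;
     rest := rest_lift;
     rest_R1 := rest_lift_R1;
     rest_R2 := rest_lift_R2;
     rest_R3 := rest_lift_R3;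
     rest_R4 := rest_lift_R4 |}.

Definition lifted_functor : RestrictionFunctor lifted_category D :=
  {| rfun := ufun F : Functor lifted_category D;
     rfun_rest := img_rest_lift |}.

(** * The order of the lifted category *)

Lemma cell_of_rle (A B : C) (f g : hom A B) :
  rle (C := lifted_category) f g -> cell f g.
Proof.
  intros E; rewrite <- E; exact (comp_rest_lift_below g f).
Qed.

Lemma rle_of_cell (A B : C) (f g : hom A B) :
  cell f g -> rle (C := lifted_category) f g.
Proof.
  intros a; apply (below_cancel (comp_rest_lift_below g f) a).
  rewrite img_comp, img_rest_lift; exact (cmap F a).
Qed.

Definition lifted_comparison : TwoFunctor (Gamma lifted_category) C.
Proof.
  refine {| ufun := id_functor C : Functor (Gamma lifted_category) C;
            cmap := @cell_of_rle |};
  intros; apply cell_unique.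
Defined.

Lemma lifted_comparison_bijective (A B : C) (f g : hom A B) :
  bijective (fun a : cell (t := Gamma lifted_category) f g =>
    cmap lifted_comparison a).
Proof.
  intros b; exists (rle_of_cell b); split.
  - apply cell_unique.
  - intros a _; exact (proof_irrelevance (rle _ _) _ _).
Qed.

Definition lifted_identification : Identification (Gamma lifted_category) C :=
  {| ident_fun := lifted_comparison;
     ident_eq := eq_refl : underlying (Gamma lifted_category) = underlying C;
     ident_id := eq_refl;
     ident_bij := lifted_comparison_bijective |}.

Lemma lifted_functor_over :
  Gamma_functor lifted_functor = comp_two_functor F lifted_identification.
Proof.
  apply two_functor_into_Gamma_ext; symmetry; exact (comp_functor_idr (ufun F)).
Qed.

(** The identification sends the inequality [rest f <= idm A] of the other
    restriction category to a 2-cell of [C], which is what puts that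
    restriction within the scope of cancellation. *)
Lemma lifted_functor_unique (P : RestrictionFunctorInto D)
  (I : Identification (Gamma (projT1 P)) C) :
  Gamma_functor (projT2 P) = comp_two_functor F I ->
  existT _ lifted_category lifted_functor = P.
Proof.
  intros H.
  apply (@restriction_functor_into_unique D P
    (existT _ lifted_category lifted_functor)
    (fun A B f g => inhabited (cell (t := C) f g))) with (e := ident_eq I); cbn.
  - intros A B f g h [a] [b]; exact (below_cancel a b).
  - intros A B f; exact (inhabits (rest_lift_below f)).
  - intros A B f.
    assert (L := inhabits (cmap I (rest_rle_id f))).
    rewrite (ident_id I) in L; exact L.
  - apply (f_equal (@ufun _ _)) in H; cbn in H.
    rewrite (ident_id I) in H; exact H.
Qed.

End Lifting.

Theorem proposition4p3 :
  forall (D : RestrictionCategory) (C : TwoCategory)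
         (F : TwoFunctor C (Gamma D)),
    local_discrete_fibration F ->
    exists! P : RestrictionFunctorInto D,
      exists I : Identification (Gamma (projT1 P)) C,
        Gamma_functor (projT2 P) = comp_two_functor F I.
Proof.
  intros D C F HF.
  exists (existT _ (lifted_category HF) (lifted_functor HF)); split.
  - exists (lifted_identification HF); apply lifted_functor_over.
  - intros P [I H]; exact (lifted_functor_unique HF H).
Qed.
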